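(* Let $A_t$ be a strictly stable process with Hurst parameter $1/\beta$, and for $s>0$ let $Y_t^{s}=A_{E_{t+s}}-A_{E_{s}}$, $t\ge0$, where $E_t$ is the inverse of a stable subordinator of index $0<\alpha<1$ independent of $A_t$. Then for every $a>0$, $t_0>0$, $k\ge1$ and $0<t_1<t_2<\cdots<t_k$, $$\left(Y_{at_1}^{t_0},Y_{at_2}^{t_0},\ldots,Y_{at_k}^{t_0}\right)\overset{d}{=}\left(a^{\frac{\alpha}{\beta}}Y_{t_1}^{\frac{t_0}{a}},a^{\frac{\alpha}{\beta}}Y_{t_2}^{\frac{t_0}{a}},\ldots,a^{\frac{\alpha}{\beta}}Y_{t_k}^{\frac{t_0}{a}}\right),$$ where $\overset{d}{=}$ denotes equality in distribution.
   Context: $(A_t)_{t\ge0}$ is a real-valued Lévy process with $A_0=0$. It is strictly stable with Hurst parameter $1/\beta$, meaning that for every $a>0$ the process $(A_{at})_{t\ge0}$ has the same finite dimensional distributions as $(a^{1/\beta}A_t)_{t\ge0}$. $(D_t)_{t\ge 0}$ is a stable subordinator of index $0<\alpha<1$ with $D_0=0$ and $E(e^{-uD_t})=e^{-tcu^{\alpha}}$ for $u\ge0$ (for some constant $c>0$), independent of $(A_t)$. Its inverse is $E_t=\inf\{s: D_s>t\}$. *)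

(* Defs.v *)
From HB Require Import structures.
From mathcomp Require Import all_boot all_order all_algebra.
From mathcomp Require Import all_classical all_reals all_analysis.

Set Implicit Arguments.
Unset Strict Implicit.
Unset Printing Implicit Defensive.

Import Order.TTheory GRing.Theory Num.Theory.
Import numFieldNormedType.Exports.

Local Open Scope classical_set_scope.
Local Open Scope ring_scope.

(* A process is a family X : R -> {RV P >-> R}, of which only the times t >= 0
   are ever considered. *)

(* Equality in distribution of maps that are measurable up to a P-null set: P is
   not assumed complete and paths are cadlag only almost surely, so that a
   time-changed variable such as A_(E_t) may be measurable only after a
   modification on a null set.  For measurable maps this is the usual notion,
   see eq_distP. *)
Definition eq_dist d (T : measurableType d) (R : realType)
    (P : probability T R) d' (U : measurableType d') (X Y : T -> U) : Prop :=
  exists X' Y' : T -> U,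
    [/\ measurable_fun setT X', measurable_fun setT Y',
        (\forall w \ae P, X w = X' w), (\forall w \ae P, Y w = Y' w) &
        forall B : set U, measurable B -> P (X' @^-1` B) = P (Y' @^-1` B)].

Lemma eq_distP d (T : measurableType d) (R : realType) (P : probability T R)
    d' (U : measurableType d') (X Y : T -> U) :
    measurable_fun setT X -> measurable_fun setT Y ->
  eq_dist P X Y <->
  (forall B : set U, measurable B -> P (X @^-1` B) = P (Y @^-1` B)).
Proof.
move=> mX mY; split=> [[X' [Y' [mX' mY' XX' YY' eqB]]] B mB|eqB]; last first.
  by exists X, Y; split=> //; exact: aeW.
suff aeP (Z Z' : T -> U) : measurable_fun setT Z -> measurable_fun setT Z' ->
    (\forall w \ae P, Z w = Z' w) -> P (Z @^-1` B) = P (Z' @^-1` B).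
  by rewrite (aeP X X')// (aeP Y Y')// eqB.
move=> mZ mZ' [N [mN PN0 sN]].
have mp (V : T -> U) : measurable_fun setT V -> measurable (V @^-1` B).
  by move=> mV; rewrite -[_ @^-1` _]setTI; exact: mV.
have le (V V' : T -> U) : measurable_fun setT V -> measurable_fun setT V' ->
    [set w | V w != V' w] `<=` N -> (P (V @^-1` B) <= P (V' @^-1` B))%E.
  move=> mV mV' sV; rewrite -[leRHS]adde0 -PN0.
  apply: le_trans (measureU2 _ (mp _ mV') mN).
  apply: le_measure; rewrite ?inE; [exact: mp|exact: measurableU (mp _ mV') mN|].
  by move=> w /= Bw; case: (pselect (V w = V' w)) => [<-|/eqP ?];
    [left|right; exact: sV].
apply/eqP; rewrite eq_le !le// => w /eqP /= ne; apply: sN => //= e.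
  exact: ne.
Qed.

Section processes.
Context d (T : measurableType d) (R : realType) (P : probability T R).
Implicit Types X A D : R -> {RV P >-> R}.

Definition cadlag (f : R -> R) : Prop :=
  (forall t : R, 0 <= t -> f s @[s --> t^'+] --> f t) /\
  (forall t : R, 0 < t -> cvg (f s @[s --> t^'-])).

(* Mutual independence of n consecutive increments; the product rule for
   subfamilies is the case B i = setT for the other indices. *)
Definition independent_increments X : Prop :=
  forall (t : nat -> R), 0 <= t 0%N -> nondecreasing_seq t ->
  forall (n : nat) (B : nat -> set R), (forall i, measurable (B i)) ->
    P (\bigcap_(i < n) [set w | B i (X (t i.+1) w - X (t i) w)]) =
    (\prod_(i < n) P [set w | B i (X (t i.+1) w - X (t i) w)%R])%E.

Definition stationary_increments X : Prop :=
  forall s t : R, 0 <= s -> 0 <= t ->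
    eq_dist P (fun w => X (s + t) w - X s w) (X t).

Definition stochastically_continuous X : Prop :=
  forall t : R, 0 <= t -> forall e : R, 0 < e ->
    P [set w | e < `|X s w - X t w|] @[s --> within [set s : R | 0 <= s] (nbhs t)]
      --> 0%E.

Definition levy_process X : Prop :=
  [/\ (\forall w \ae P, X 0 w = 0),
      independent_increments X,
      stationary_increments X,
      stochastically_continuous X &
      \forall w \ae P, cadlag (X ^~ w)].

Definition strictly_stable X (H : R) : Prop :=
  levy_process X /\
  forall a : R, 0 < a -> forall (k : nat) (t : 'I_k -> R), (forall i, 0 <= t i) ->
    eq_dist P (fun w => [tuple X (a * t i) w | i < k])
              (fun w => [tuple a `^ H * X (t i) w | i < k]).

Definition stable_subordinator D (alpha c : R) : Prop :=
  [/\ levy_process D,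
      (\forall w \ae P, forall s t : R, 0 <= s -> s <= t -> D s w <= D t w) &
      forall t u : R, 0 <= t -> 0 <= u ->
        ('E_P[fun w => expR (- (u * D t w))] =
         (expR (- (t * c * u `^ alpha)))%R%:E)%E].

Definition process_sigma_algebra X : set (set T) :=
  <<s \bigcup_(t in [set t : R | 0 <= t])
        preimage_set_system setT (X t) measurable >>.

Definition independent_processes X Y : Prop :=
  forall F G, process_sigma_algebra X F -> process_sigma_algebra Y G ->
    P (F `&` G) = (P F * P G)%E.

(* E_t = inf {s >= 0 : D_s > t}.  The set is nonempty almost surely for a stable
   subordinator; on the exceptional null event, inf takes the value 0. *)
Definition inverse_process D (t : R) (w : T) : R :=
  inf [set s : R | 0 <= s /\ t < D s w].

Definition time_changed_increment A D (s t : R) (w : T) : R :=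
  A (inverse_process D (t + s) w) w - A (inverse_process D s w) w.

End processes.

(* Main.v *)
Require Import Defs.
From HB Require Import structures.
From mathcomp Require Import all_boot all_order all_algebra.
From mathcomp Require Import all_classical all_reals all_analysis.
From mathcomp Require Import measurable_realfun ring lra.
Import Order.TTheory GRing.Theory Num.Theory.
Import numFieldNormedType.Exports.
Local Open Scope classical_set_scope.
Local Open Scope ring_scope.

(** Let b = a^alpha.  The time change E is self-similar of index alpha: the
first-passage events satisfy E_s < x => D_x > s => E_s <= x almost surely, so
that the self-similarity of D, of index 1/alpha, inverts to
(E_(a s)) =d (b E_s) ([inverse_selfsimilar]).  As A is independent of E, one
may condition on E and use the self-similarity of A, of index 1/beta:
(A_(E_(a s))) =d (A_(b E_s)) =d (b^(1/beta) A_(E_s)) for finitely many times s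
jointly ([time_change_selfsimilar]), and b^(1/beta) = a^(alpha/beta).  The
theorem is this identity at the times t0/a and t_i + t0/a, followed by the map
that subtracts the first coordinate from the others.

Conditioning is replaced by discretization.  E is rounded up to the grid of
mesh 1/n; then E takes countably many values, and the law of A at the rounded
time is a countable sum of products ([eq_dist_randomized]).  As n grows, the
rounded times tend to E from strictly above and right-continuity of the paths
of A gives convergence almost surely.  The same rounding deduces the
self-similarity of D from its version on a grid, where the increments are
independent and have the law of one variable, known by its Laplace transform
([eq_dist_laplace]).

Limits of equal laws, uniqueness of Laplace transforms and the inversion of D
rest on one criterion, [eq_dist_sandwich]: X and Y have the same law as soon as
P(X_i < x_i for all i) <= P(Y_i < x_i + e for all i) for all x and e > 0, and
conversely.  The slack e absorbs the boundary effects in limits of sequences,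
in the polynomial approximation of an indicator function and in the passage
from {E_s <= x} to {E_s < x}.

E_t is an infimum over uncountably many times and need not be measurable.  It
is almost surely equal to the infimum over rational times
([rational_inverse]), which is measurable for the sigma-algebra of D; this is
also what makes it independent of A. *)

(** * Equality in distribution and lower boxes *)

Section equality_in_distribution.
Set Implicit Arguments.
Unset Strict Implicit.
Context {d : measure_display} {T : measurableType d} {R : realType}.
Context {P : probability T R}.

Lemma eq_dist_ae {d'} {U : measurableType d'} (X Y X1 Y1 : T -> U) :
  (\forall w \ae P, X1 w = X w) -> (\forall w \ae P, Y1 w = Y w) ->
  eq_dist P X Y -> eq_dist P X1 Y1.
Proof.
move=> XX1 YY1 [X' [Y' [mX mY XX YY XY]]]; exists X', Y'; split=> //.
- by apply: filterS2 XX XX1 => w <- <-.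
- by apply: filterS2 YY YY1 => w <- <-.
Qed.

Lemma eq_dist_comp {d' d''} {U : measurableType d'} {V : measurableType d''}
    (g : U -> V) (X Y : T -> U) : measurable_fun setT g ->
  eq_dist P X Y -> eq_dist P (g \o X) (g \o Y).
Proof.
move=> mg [X' [Y' [mX mY XX YY XY]]].
exists (g \o X'), (g \o Y'); split.
- exact: measurableT_comp.
- exact: measurableT_comp.
- by apply: filterS XX => w /= ->.
- by apply: filterS YY => w /= ->.
- move=> B mB; apply: (XY (g @^-1` B)).
  by rewrite -[_ @^-1` _]setTI; exact: mg.
Qed.

Lemma measurable_preimage {d1 d2} {U : measurableType d1} {V : measurableType d2}
    (f : U -> V) (B : set V) :
  measurable_fun setT f -> measurable B -> measurable (f @^-1` B).
Proof. by move=> mf mB; rewrite -[_ @^-1` _]setTI; exact: mf. Qed.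

Lemma measurable_mktuple {d1} {U : measurableType d1} {k} (f : 'I_k -> U -> R) :
  (forall i, measurable_fun setT (f i)) ->
  measurable_fun setT (fun u => [tuple f i u | i < k]).
Proof.
move=> mf; apply/measurable_fun_tnthP => i.
by apply: eq_measurable_fun (mf i) => u _ /=; rewrite tnth_mktuple.
Qed.

Definition box {k} (x : 'I_k -> R) : set (k.-tuple R) :=
  [set t | forall i, tnth t i < x i].

Lemma measurable_rectangle {k} (B : 'I_k -> set R) :
  (forall i, measurable (B i)) ->
  measurable [set t : k.-tuple R | forall i, B i (tnth t i)].
Proof.
move=> mB.
have -> : [set t : k.-tuple R | forall i, B i (tnth t i)] =
    \bigcap_(i in setT) ((fun t => tnth t i) @^-1` B i).
  by apply/seteqP; split=> t h i; [move=> _; exact: h|exact: h i I].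
apply: fin_bigcap_measurable => // i _; apply: measurable_preimage => //.
exact: measurable_tnth.
Qed.

Lemma measurable_box {k} (x : 'I_k -> R) : measurable (box x).
Proof.
have -> : box x = [set t | forall i, `]-oo, x i[%classic (tnth t i)].
  by apply/seteqP; split=> t h i; have := h i; rewrite /= in_itv.
apply: (measurable_rectangle (B := fun i => `]-oo, x i[%classic)) => i.
exact: measurable_itv.
Qed.

Lemma le_measure_ae (A B : set T) : measurable A -> measurable B ->
  (\forall w \ae P, A w -> B w) -> (P A <= P B)%E.
Proof.
move=> mA mB [N [mN N0 sN]]; rewrite -[leRHS]adde0 -N0.
apply: le_trans (measureU2 _ mB mN).
apply: le_measure; rewrite ?inE//; first exact: measurableU.
move=> w Aw; have [Bw|Bw] := pselect (B w); [by left|right].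
by apply: sN => /(_ Aw).
Qed.

(** Lower boxes form a pi-system, hence the interest of this generating
family: it turns equality of laws into a statement on distribution functions. *)
Lemma measurable_tuple_box {k} :
  @measurable _ (k.-tuple R) = <<s range (@box k) >>.
Proof.
apply/seteqP; split=> [|A]; last first.
  apply: smallest_sub; first exact: sigma_algebra_measurable.
  by move=> _ [x _ <-]; exact: measurable_box.
set G := range _.
apply: smallest_sub; first exact: smallest_sigma_algebra.
move=> A; rewrite -bigcup_seq/= => -[i /= _ [B mB <-{A}]].
pose f := (fun t => tnth t i) : g_sigma_algebraType G -> R.
suff mf : measurable_fun setT f by exact: mf.
apply: (measurability _ (RGenInftyO.measurableE R)).
move=> _ [_ [x ->] <-]; rewrite setTI.
(* The coordinates other than i are left free by letting their bound n grow. *)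
have -> : f @^-1` `]-oo, x[ =
    \bigcup_n box (fun j : 'I_k => if j == i then x else n%:R).
  apply/seteqP; split=> t; rewrite /f /= in_itv/=; last first.
    by move=> [n _] /(_ i); rewrite eqxx.
  move=> tx; exists (Num.truncn (\sum_(j < k) `|tnth t j|)).+1 => //= j.
  case: eqP => [->//|_].
  apply: le_lt_trans (truncnS_gt _); rewrite (bigD1 j)//=.
  by apply: le_trans (ler_norm _) _; rewrite lerDl sumr_ge0.
apply: bigcupT_measurable => n.
by apply: sub_sigma_algebra; exists (fun j : 'I_k => if j == i then x else n%:R).
Qed.

Lemma eq_law_box {k} (X Y : T -> k.-tuple R) :
  measurable_fun setT X -> measurable_fun setT Y ->
  (forall x, P (X @^-1` box x) = P (Y @^-1` box x)) ->
  forall B, measurable B -> P (X @^-1` B) = P (Y @^-1` B).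
Proof.
move=> mX mY XY B mB.
apply: (dynkin_induction (G := range (@box k))
   (P := fun B => P (X @^-1` B) = P (Y @^-1` B))) => //.
- exact: measurable_tuple_box.
- move=> _ _ [x _ <-] [y _ <-]; exists (fun i => Num.min (x i) (y i)) => //.
  apply/seteqP; split=> t /=; rewrite /box/=.
    by move=> h; split=> i; have := h i; rewrite lt_min => /andP[].
  by move=> [h1 h2] i; rewrite lt_min h1 h2.
- by move=> _ [x _ <-]; exact: XY.
- move=> S mS eS.
  have PC (Z : T -> k.-tuple R) : measurable_fun setT Z ->
      P (Z @^-1` (~` S)) = (1 - P (Z @^-1` S))%E.
    by move=> mZ; rewrite -probability_setC//; exact: measurable_preimage.
  by rewrite !PC// eS.
- move=> F mF tF eF.
  have PU (Z : T -> k.-tuple R) : measurable_fun setT Z ->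
      P (Z @^-1` (\bigcup_n F n)) = (\sum_(n <oo) P (Z @^-1` F n))%E.
    move=> mZ; rewrite preimage_bigcup measure_bigcup//.
    - by apply: eq_eseriesl => n; rewrite in_setT.
    - by move=> n _; exact: measurable_preimage.
    - by move=> i j _ _ [w [Fi Fj]]; apply: tF => //; exists (Z w).
  by rewrite !PU//; apply: eq_eseriesr => n _; exact: eF.
- by rewrite -measurable_tuple_box.
Qed.

(** The box below x is the increasing union of the boxes below x - 1/n, so the
slack e = 1/n disappears by continuity of P from below. *)
Lemma eq_dist_sandwich {k} (X Y : T -> k.-tuple R) :
  measurable_fun setT X -> measurable_fun setT Y ->
  (forall (x : 'I_k -> R) (e : R), 0 < e ->
    (P (X @^-1` box x) <= P (Y @^-1` box (fun i => x i + e)%R))%E) ->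
  (forall (x : 'I_k -> R) (e : R), 0 < e ->
    (P (Y @^-1` box x) <= P (X @^-1` box (fun i => x i + e)%R))%E) ->
  eq_dist P X Y.
Proof.
suff le (X1 X2 : T -> k.-tuple R) :
    measurable_fun setT X1 -> measurable_fun setT X2 ->
    (forall (x : 'I_k -> R) (e : R), 0 < e ->
      (P (X1 @^-1` box x) <= P (X2 @^-1` box (fun i => x i + e)%R))%E) ->
    forall x, (P (X1 @^-1` box x) <= P (X2 @^-1` box x))%E.
  move=> mX mY XY YX; apply/(eq_distP P mX mY).
  by apply: eq_law_box => // x; apply/eqP; rewrite eq_le !le.
move=> mX1 mX2 X12 x.
pose F n := X1 @^-1` box (fun i => x i - n.+1%:R^-1).
have mF n : measurable (F n).
  by apply: measurable_preimage => //; exact: measurable_box.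
have UF : X1 @^-1` box x = \bigcup_n F n.
  apply/seteqP; split=> w /=; last first.
    move=> [n _ h] i; apply: lt_trans (h i) _.
    by rewrite ltrBlDr ltrDl invr_gt0 ltr0n.
  (* n must exceed every 1 / (x i - X1 i); their sum dominates each of them. *)
  move=> h; exists (Num.truncn (\sum_(i < k) (x i - tnth (X1 w) i)^-1)) => //= i.
  rewrite ltrBrDr addrC -ltrBrDr invf_plt ?posrE ?subr_gt0 ?ltr0n//.
  apply: le_lt_trans (truncnS_gt _); rewrite (bigD1 i)//= lerDl sumr_ge0// => j _.
  by rewrite invr_ge0 subr_ge0 ltW.
have ndF : nondecreasing_seq F.
  move=> m n mn; apply/subsetPset => w h i; apply: lt_le_trans (h i) _.
  by rewrite lerB// lef_pV2 ?posrE ?ltr0n// ler_nat ltnS.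
have cF := nondecreasing_cvg_mu (mu := P) mF (bigcupT_measurable _ mF) ndF.
rewrite UF -(cvg_lim _ cF)//; apply: lime_le; first by apply/cvg_ex; eexists; exact: cF.
apply: nearW => n /=.
apply: le_trans (X12 _ n.+1%:R^-1 _) _; first by rewrite invr_gt0 ltr0n.
by under [in leLHS]eq_fun do rewrite subrK.
Qed.

(** If W0 lies in the open box then so does W n eventually, and if V n lies in
it infinitely often then V0 lies in its closure.  Hence, by continuity of P
along monotone sequences,
P(W0 in box) <= P(liminf {W n in box}) <= P(limsup {V n in box}), and the last
event lies in the enlarged box. *)
Lemma le_box_cvg {k} (W V : nat -> T -> k.-tuple R) (W0 V0 : T -> k.-tuple R) :
  (forall n, measurable_fun setT (W n)) -> (forall n, measurable_fun setT (V n)) ->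
  measurable_fun setT W0 -> measurable_fun setT V0 ->
  (forall n B, measurable B -> P (W n @^-1` B) = P (V n @^-1` B)) ->
  (forall w i, tnth (W n w) i @[n --> \oo] --> tnth (W0 w) i) ->
  (forall w i, tnth (V n w) i @[n --> \oo] --> tnth (V0 w) i) ->
  forall (x : 'I_k -> R) (e : R), 0 < e ->
  (P (W0 @^-1` box x) <= P (V0 @^-1` box (fun i => x i + e)%R))%E.
Proof.
move=> mW mV mW0 mV0 WV WW VV x e e0.
pose F m := \bigcap_(n in [set n | (m <= n)%N]) (W n @^-1` box x).
pose G m := \bigcup_(n in [set n | (m <= n)%N]) (V n @^-1` box x).
have mWx n : measurable (W n @^-1` box x).
  by apply: measurable_preimage => //; exact: measurable_box.
have mVx n : measurable (V n @^-1` box x).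
  by apply: measurable_preimage => //; exact: measurable_box.
have mF m : measurable (F m) by exact: bigcap_measurableType.
have mG m : measurable (G m) by exact: bigcup_measurable.
have mUF : measurable (\bigcup_m F m) by exact: bigcupT_measurable.
have mIG : measurable (\bigcap_m G m) by exact: bigcapT_measurable.
have ndF : nondecreasing_seq F.
  move=> m n mn; apply/subsetPset => w h j /= nj.
  by apply: h; exact: leq_trans nj.
have niG : nonincreasing_seq G.
  move=> m n mn; apply/subsetPset => w [j /= nj h].
  by exists j => //=; exact: leq_trans nj.
have FG m n : (P (F m) <= P (G n))%E.
  apply: (@le_trans _ _ (P (W (maxn m n) @^-1` box x))).
    by apply: le_measure; rewrite ?inE// => w; apply; rewrite /= leq_maxl.
  rewrite WV; last exact: measurable_box.
  apply: le_measure; rewrite ?inE// => w h; exists (maxn m n) => //=.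
  by rewrite leq_maxr.
apply: (@le_trans _ _ (P (\bigcup_m F m))).
  apply: le_measure; rewrite ?inE//.
    by apply: measurable_preimage => //; exact: measurable_box.
  move=> w /= h.
  have /filter_forall [m _ hm] : forall i, \forall n \near \oo, tnth (W n w) i < x i.
    by move=> i; apply: (cvgr_lt _ (WW w i)); exact: h.
  by exists m => // n /= mn i; exact: hm.
apply: (@le_trans _ _ (P (\bigcap_m G m))); last first.
  apply: le_measure; rewrite ?inE//.
    by apply: measurable_preimage => //; exact: measurable_box.
  move=> w h i; rewrite ltNge; apply/negP => xe.
  have [m _ hm] : \forall n \near \oo, x i < tnth (V n w) i.
    by apply: (cvgr_gt _ (VV w i)); apply: lt_le_trans xe; rewrite ltrDl.
  have [n /= mn /(_ i)] := h m I.
  by rewrite ltNge (ltW (hm _ mn)).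
have cF := nondecreasing_cvg_mu (mu := P) mF mUF ndF.
have G0 : (P (G 0%N) < +oo)%E by rewrite (le_lt_trans (probability_le1 _ _)) ?ltry.
have cG := nonincreasing_cvg_mu G0 mG mIG niG.
rewrite -(cvg_lim _ cF)//; apply: lime_le.
  by apply/cvg_ex; eexists; exact: cF.
apply: nearW => m; rewrite -(cvg_lim _ cG)//; apply: lime_ge.
  by apply/cvg_ex; eexists; exact: cG.
by apply: nearW => n; exact: FG.
Qed.

(** The measurable modifications of all the W n and V n agree with them off a
single null set N; setting every coordinate to 0 on N makes convergence hold
everywhere, so that the limits are measurable and [le_box_cvg] applies. *)
Lemma eq_dist_cvg {k} (W V : nat -> T -> k.-tuple R) (W0 V0 : T -> k.-tuple R) :
  (forall n, eq_dist P (W n) (V n)) ->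
  (\forall w \ae P, forall i, tnth (W n w) i @[n --> \oo] --> tnth (W0 w) i) ->
  (\forall w \ae P, forall i, tnth (V n w) i @[n --> \oo] --> tnth (V0 w) i) ->
  eq_dist P W0 V0.
Proof.
move=> /(_ _)/cid - /all_sig[W' /(_ _)/cid - /all_sig[V' WV]] WW VV.
have /ae_foralln eW : forall n, \forall w \ae P, W n w = W' n w.
  by move=> n; have [] := WV n.
have /ae_foralln eV : forall n, \forall w \ae P, V n w = V' n w.
  by move=> n; have [] := WV n.
have [N [mN PN sN]] : \forall w \ae P, 
    (forall i, tnth (W' n w) i @[n --> \oo] --> tnth (W0 w) i) /\
    (forall i, tnth (V' n w) i @[n --> \oo] --> tnth (V0 w) i).
  have h1 : \forall w \ae P, forall i, tnth (W' n w) i @[n --> \oo] --> tnth (W0 w) i.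
    apply: filterS2 eW WW => w ew h i.
    by under eq_fun do rewrite -ew; exact: h.
  have h2 : \forall w \ae P, forall i, tnth (V' n w) i @[n --> \oo] --> tnth (V0 w) i.
    apply: filterS2 eV VV => w ew h i.
    by under eq_fun do rewrite -ew; exact: h.
  by apply: filterS2 h1 h2.
pose cut (X : T -> k.-tuple R) w := [tuple \1_(~` N) w * tnth (X w) i | i < k].
have cutN X w : ~ N w -> cut X w = X w.
  move=> Nw; apply: eq_from_tnth => i; rewrite tnth_mktuple indicE mem_set//.
  by rewrite mul1r.
have cutE X : \forall w \ae P, X w = cut X w.
  exists N; split=> // w /= h; apply: contrapT => Nw; apply: h.
  by rewrite cutN.
have mcut X : measurable_fun setT X -> measurable_fun setT (cut X).
  move=> /measurable_fun_tnthP mX; apply: measurable_mktuple => i.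
  apply: measurable_funM; last exact: mX.
  by apply: measurable_indic; exact: measurableC.
have ccut (X : nat -> T -> k.-tuple R) (X0 : T -> k.-tuple R) : 
    (forall w, ~ N w -> forall i, tnth (X n w) i @[n --> \oo] --> tnth (X0 w) i) ->
    forall w i, tnth (cut (X n) w) i @[n --> \oo] --> tnth (cut X0 w) i.
  move=> h w i; rewrite tnth_mktuple; under eq_fun do rewrite tnth_mktuple.
  have [Nw|Nw] := pselect (N w); last by apply: cvgMr; exact: h.
  rewrite indicE memNset/= ?mul0r; last by move=> /(_ Nw).
  by under eq_fun do rewrite mul0r; exact: cvg_cst.
have hN w : ~ N w -> (forall i, tnth (W' n w) i @[n --> \oo] --> tnth (W0 w) i) /\
    (forall i, tnth (V' n w) i @[n --> \oo] --> tnth (V0 w) i).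
  by move=> Nw; apply: contrapT => h; apply: Nw; exact: sN.
have cW := ccut W' W0 (fun w Nw => (hN w Nw).1).
have cV := ccut V' V0 (fun w Nw => (hN w Nw).2).
have mW n : measurable_fun setT (cut (W' n)) by apply: mcut; have [] := WV n.
have mV n : measurable_fun setT (cut (V' n)) by apply: mcut; have [] := WV n.
have mlim (X : nat -> T -> k.-tuple R) (X0 : T -> k.-tuple R) :
    (forall n, measurable_fun setT (X n)) ->
    (forall w i, tnth (X n w) i @[n --> \oo] --> tnth (X0 w) i) ->
    measurable_fun setT X0.
  move=> mX cX; apply/measurable_fun_tnthP => i.
  apply: (measurable_fun_cvg (h := fun n w => tnth (X n w) i)) => [n|w _].
    by have /measurable_fun_tnthP := mX n; exact.
  exact: cX.
have mW0 := mlim _ _ mW cW; have mV0 := mlim _ _ mV cV.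
have eqL n B : measurable B -> P (cut (W' n) @^-1` B) = P (cut (V' n) @^-1` B).
  move: B; apply/(eq_distP P (mW n) (mV n)).
  have [mW' mV' _ _ eqB] := WV n.
  exists (W' n), (V' n); split=> //; apply: filterS (cutE _) => w; exact: esym.
apply: (eq_dist_ae (cutE W0) (cutE V0)).
apply: eq_dist_sandwich => // x e e0.
- exact: (le_box_cvg mW mV).
- by apply: (le_box_cvg mV mW) => // n B mB; rewrite eqL.
Qed.

End equality_in_distribution.

(** * Uniqueness of Laplace transforms *)

Section laplace_uniqueness.
Set Implicit Arguments.
Unset Strict Implicit.
Context {d : measure_display} {T : measurableType d} {R : realType}.
Context {P : probability T R}.

Lemma bernoulli_ineq (y : R) N : 0 <= y <= 1 -> 1 - N%:R * y <= (1 - y) ^+ N.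
Proof.
move=> /andP[y0 y1]; elim: N => [|N IH]; first by rewrite mul0r subr0 expr0.
rewrite exprS; apply: le_trans (_ : (1 - y) * (1 - N%:R * y) <= _); last first.
  by rewrite ler_wpM2l// subr_ge0.
rewrite -natr1; have : 0 <= N%:R * y * y by rewrite !mulr_ge0.
lra.
Qed.

(** With y = v^n this bounds (1 - y)^N by 1 / (N y), which is what makes
[poly_step_approx] close to 1 above the threshold. *)
Lemma bernoulli_ineq_inv (y : R) N : 0 <= y <= 1 -> (1 - y) ^+ N * (1 + N%:R * y) <= 1.
Proof.
move=> /andP[y0 y1]; elim: N => [|N IH]; first by rewrite mul0r addr0 expr0 mulr1.
apply: le_trans IH; rewrite exprS mulrC mulrA -mulrC ler_wpM2l//.
  by rewrite exprn_ge0// subr_ge0.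
rewrite -natr1; have : 0 <= N%:R * y * y by rewrite !mulr_ge0.
nra.
Qed.

(** The polynomial 1 - (1 - v^n)^N rises from about N v^n while N v^n is small
to about 1 once N v^n is large.  Since (v1 / v0)^n grows without bound, N can
be chosen with N v0^n small and N v1^n large. *)
Lemma poly_step_approx (v0 v1 e : R) : 0 < v0 -> v0 < v1 -> v1 <= 1 -> 0 < e ->
  exists p : {poly R}, [/\ forall v, 0 <= v <= 1 -> 0 <= p.[v] <= 1,
    forall v, 0 <= v <= v0 -> p.[v] <= e &
    forall v, v1 <= v <= 1 -> 1 - e <= p.[v] ].
Proof.
move=> v00 v01 v11 e0.
have v10 : 0 < v1 by exact: lt_trans v01.
have r1 : `|v0 / v1| < 1.
  by rewrite ger0_norm ?divr_ge0 ?ltW// ltr_pdivrMr// mul1r.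
(* For this n and N, 1/e <= N v1^n and
   N v0^n <= (1/e + 1) (v0 / v1)^n <= e. *)
have [n _ hn] : \forall n \near \oo, (v0 / v1) ^+ n < e / (e^-1 + 1).
  apply: (cvgr_lt _ (cvg_expr r1)).
  by rewrite divr_gt0// addr_gt0// invr_gt0.
have {hn} := hn n (leqnn n) => /= hn.
have v1n0 : 0 < v1 ^+ n by rewrite exprn_gt0.
have v1n1 : v1 ^+ n <= 1 by rewrite exprn_ile1// ltW.
pose N := (Num.truncn (e^-1 / v1 ^+ n)).+1.
have N1 : e^-1 / v1 ^+ n <= N%:R by rewrite ltW// truncnS_gt.
have N2 : N%:R <= e^-1 / v1 ^+ n + 1.
  by rewrite -natr1 lerD2r truncn_le// divr_ge0// ?invr_ge0 ltW.
have itv (v : R) : 0 <= v <= 1 -> 0 <= v ^+ n <= 1.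
  by move=> /andP[v_ge0 v_le1]; rewrite exprn_ge0// exprn_ile1.
exists (1 - (1 - 'X^n) ^+ N).
have pE (v : R) : (1 - (1 - 'X^n) ^+ N).[v] = 1 - (1 - v ^+ n) ^+ N.
  by rewrite !hornerE.
split=> v; rewrite pE.
- move=> /itv/andP[vn0 vn1].
  have a0 : 0 <= (1 - v ^+ n) ^+ N by rewrite exprn_ge0// subr_ge0.
  have a1 : (1 - v ^+ n) ^+ N <= 1 by rewrite exprn_ile1// ?subr_ge0// gerBl.
  by apply/andP; split; lra.
- move=> /andP[v_ge0 v_le].
  have vi : 0 <= v <= 1 by rewrite v_ge0 (le_trans v_le)// (le_trans (ltW v01)).
  have h : v ^+ n <= v0 ^+ n by rewrite lerXn2r// nnegrE ltW.
  have := bernoulli_ineq N (itv _ vi).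
  suff : N%:R * v ^+ n <= e by lra.
  apply: le_trans (_ : N%:R * v0 ^+ n <= _); first by rewrite ler_wpM2l.
  apply: le_trans (_ : (e^-1 / v1 ^+ n + 1) * v0 ^+ n <= _).
    by rewrite ler_wpM2r// exprn_ge0// ltW.
  apply: le_trans (_ : (e^-1 + 1) * (v0 / v1) ^+ n <= _); last first.
    by rewrite mulrC -ler_pdivlMr ?addr_gt0 ?invr_gt0// ltW.
  rewrite expr_div_n !mulrDl mul1r mul1r lerD//.
    by rewrite mulrAC mulrA.
  by rewrite ler_pdivlMr// ler_piMr// exprn_ge0// ltW.
- move=> /andP[v_ge v_le].
  have v_ge0 : 0 <= v by rewrite (le_trans (ltW v10)).
  have vi : 0 <= v <= 1 by rewrite v_ge0.
  have h : v1 ^+ n <= v ^+ n by rewrite lerXn2r// nnegrE ltW.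
  have := bernoulli_ineq_inv N (itv _ vi).
  set a := (1 - v ^+ n) ^+ N => ha.
  have a0 : 0 <= a by rewrite exprn_ge0// subr_ge0; case/andP: (itv _ vi).
  have Nv : e^-1 <= N%:R * v ^+ n.
    apply: le_trans (_ : N%:R * v1 ^+ n <= _); last by rewrite ler_wpM2l.
    by rewrite -ler_pdivrMr.
  suff : a <= e by lra.
  have : a * e^-1 <= 1.
    by apply: le_trans ha; rewrite ler_wpM2l//; lra.
  by rewrite ler_pdivrMr// mul1r.
Qed.

Lemma expectation_poly (U V : T -> R) (p : {poly R}) :
  measurable_fun setT U -> measurable_fun setT V ->
  (forall w, 0 <= U w <= 1) -> (forall w, 0 <= V w <= 1) ->
  (forall n : nat, expectation P (fun w => U w ^+ n) =
                   expectation P (fun w => V w ^+ n)) ->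
  expectation P (fun w => p.[U w]) = expectation P (fun w => p.[V w]).
Proof.
move=> mU mV U01 V01 UV.
have ipow (Z : T -> R) n : measurable_fun setT Z -> (forall w, 0 <= Z w <= 1) ->
    P.-integrable setT (EFin \o (fun w => Z w ^+ n)).
  move=> mZ Z01; apply: measurable_bounded_integrable => //.
  - by rewrite (le_lt_trans (probability_le1 _ _)) ?ltry.
  - exact: measurable_funX.
  - exists 1; split=> // M M1 w _ /=; have /andP[z0 z1] := Z01 w.
    by rewrite ger0_norm ?exprn_ge0// (le_trans _ (ltW M1))// exprn_ile1.
have EE (Z : T -> R) : measurable_fun setT Z -> (forall w, 0 <= Z w <= 1) ->
    expectation P (fun w => p.[Z w]) = 
      (\sum_(i < size p) (p`_i)%:E * expectation P (fun w => (Z w ^+ i)%R))%E.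
  move=> mZ Z01; rewrite unlock.
  under eq_integral do rewrite horner_coef -sumEFin.
  rewrite integral_sum//=; last first.
    move=> i; under eq_fun do rewrite EFinM.
    by apply: integrableZl => //; exact: ipow.
  apply: eq_bigr => i _; under eq_integral do rewrite EFinM.
  by rewrite integralZl//; exact: ipow.
by rewrite !EE//; apply: eq_bigr => i _; rewrite UV.
Qed.

(** The transform at the integers gives the moments of exp(-X), hence the
expectation of every polynomial in exp(-X).  A polynomial that nearly is the
indicator function of the values v >= exp(-x), except between exp(-(x + e)) and
exp(-x), compares the two distribution functions. *)
Lemma eq_law_laplace_ge0 (X Y : T -> R) :
  measurable_fun setT X -> measurable_fun setT Y ->
  (forall w, 0 <= X w) -> (forall w, 0 <= Y w) ->
  (forall n : nat, expectation P (fun w => expR (- (n%:R * X w))) =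
                   expectation P (fun w => expR (- (n%:R * Y w)))) ->
  forall x e : R, 0 < e -> (P [set w | (X w < x)%R] <= P [set w | (Y w < x + e)%R])%E.
Proof.
move=> mX mY X0 Y0 XY x e e0.
have mlt (Z : T -> R) y : measurable_fun setT Z -> measurable [set w | Z w < y].
  move=> mZ; rewrite (_ : [set _ | _] = Z @^-1` `]-oo, y[).
    exact: measurable_preimage.
  by apply/seteqP; split=> w /=; rewrite in_itv.
have [x0|x0] := leP x 0.
  rewrite (_ : [set w | X w < x] = set0) ?measure0//.
  apply/seteqP; split=> // w /= /lt_le_trans /(_ x0).
  by rewrite ltNge X0.
apply/lee_addgt0Pr => e1 e10.
pose c := e1 / 2; have c0 : 0 < c by rewrite divr_gt0.
have [||||p [p01 plo phi]] := @poly_step_approx (expR (- (x + e))) (expR (- x)) c.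
- exact: expR_gt0.
- by rewrite ltr_expR ltrN2 ltrDl.
- by rewrite -expR0 ler_expR oppr_le0 ltW.
- exact: c0.
(* Shifting p by c makes q dominate the indicator function of X < x. *)
pose q := p + c%:P.
have mE (Z : T -> R) : measurable_fun setT Z ->
    measurable_fun setT (fun w => expR (- Z w)).
  by move=> mZ; apply: measurableT_comp => //; exact: measurable_funN.
have mq (Z : T -> R) : measurable_fun setT Z ->
    measurable_fun setT (fun w => q.[expR (- Z w)]).
  move=> mZ; exact: (measurableT_comp (@measurable_poly _ q setT) (mE _ mZ)).
have E01 (Z : T -> R) w : (forall w, 0 <= Z w) -> 0 <= expR (- Z w) <= 1.
  by move=> Z0; rewrite expR_ge0 -expR0 ler_expR oppr_le0 Z0.
have qge0 v : 0 <= v <= 1 -> 0 <= q.[v].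
  by move=> /p01/andP[p0 _]; rewrite !hornerE; lra.
have qE : expectation P (fun w => q.[expR (- X w)]) =
          expectation P (fun w => q.[expR (- Y w)]).
  apply: expectation_poly => //; [exact: mE|exact: mE| | |] => [w|w|n].
  - exact: E01.
  - exact: E01.
  - have -> : (fun w => expR (- X w) ^+ n) = (fun w => expR (- (n%:R * X w))).
      by apply/funext => w; rewrite -expRM_natl mulrN.
    rewrite XY; congr expectation; apply/funext => w.
    by rewrite -expRM_natl mulrN.
rewrite -expectation_indic; last exact: mlt.
rewrite -[X in (_ <= X + _)%E]expectation_indic; last exact: mlt.
apply: (@le_trans _ _ (expectation P (fun w => q.[expR (- X w)]))).
  apply: expectation_le => //; [exact: measurable_indic (mlt _ _ mX)|exact: mq|..].
  - by move=> w; apply: qge0; exact: E01.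
  - apply: aeW => w; rewrite indicE; have [wx|wx] := boolP (w \in _); last first.
      by apply: qge0; exact: E01.
    move: wx; rewrite inE/= => wx; rewrite !hornerE.
    have : expR (- x) <= expR (- X w) <= 1.
      by rewrite ler_expR lerN2 (ltW wx)/=; case/andP: (E01 X w X0).
    by move=> /phi; lra.
rewrite qE -(expectation_cst P e1) -expectationD; last 2 first.
- by apply/Lfun1_integrable; apply: integrable_indic; exact: mlt.
- exact: Lfun_cst.
apply: expectation_le => //.
- exact: mq.
- by apply: measurable_funD => //; exact: measurable_indic (mlt _ _ mY).
- by move=> w; apply: qge0; exact: E01.
- by move=> w /=; rewrite addr_ge0// ltW.
- apply: aeW => w /=; rewrite indicE; have [wx|wx] := boolP (w \in _).
    have /p01 := E01 Y w Y0; rewrite !hornerE /= => /andP[_].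
    by rewrite /c; lra.
  move: wx; rewrite notin_setE/= => /negP; rewrite -leNgt => wx.
  have : 0 <= expR (- Y w) <= expR (- (x + e)) by rewrite expR_ge0 ler_expR lerN2.
  by move=> /plo; rewrite !hornerE/= /c; lra.
Qed.

Lemma eq_dist_laplace (X Y : T -> R) :
  measurable_fun setT X -> measurable_fun setT Y ->
  (\forall w \ae P, 0 <= X w) -> (\forall w \ae P, 0 <= Y w) ->
  (forall n : nat, expectation P (fun w => expR (- (n%:R * X w))) =
                   expectation P (fun w => expR (- (n%:R * Y w)))) ->
  eq_dist P X Y.
Proof.
move=> mX mY X0 Y0 XY.
pose X1 w := `|X w|; pose Y1 w := `|Y w|.
have mX1 : measurable_fun setT X1 by exact: measurableT_comp.
have mY1 : measurable_fun setT Y1 by exact: measurableT_comp.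
have E1 (Z : T -> R) n : measurable_fun setT Z -> (\forall w \ae P, 0 <= Z w) ->
    expectation P (fun w => expR (- (n%:R * `|Z w|))) =
    expectation P (fun w => expR (- (n%:R * Z w))).
  move=> mZ Z0; rewrite unlock; apply: ae_eq_integral => //.
  - apply/measurable_EFinP; do 2 apply: measurableT_comp => //.
    by apply: measurable_funM => //; exact: measurableT_comp.
  - apply/measurable_EFinP; do 2 apply: measurableT_comp => //.
    by apply: measurable_funM.
  - by apply: filterS Z0 => w /= z _; rewrite ger0_norm.
have XY1 n : expectation P (fun w => expR (- (n%:R * X1 w))) =
             expectation P (fun w => expR (- (n%:R * Y1 w))).
  exact: etrans (E1 X n mX X0) (etrans (XY n) (esym (E1 Y n mY Y0))).
have mt (Z : T -> R) : measurable_fun setT Z ->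
    measurable_fun setT (fun w => [tuple Z w | i < 1]).
  by move=> mZ; exact: measurable_mktuple.
have bE (Z : T -> R) x :
    (fun w => [tuple Z w | i < 1]) @^-1` box x = [set w | Z w < x ord0].
  apply/seteqP; split=> w /=; first by move=> /(_ ord0); rewrite tnth_mktuple.
  by move=> h i; rewrite tnth_mktuple ord1.
have : eq_dist P (fun w => [tuple X1 w | i < 1]) (fun w => [tuple Y1 w | i < 1]).
  apply: eq_dist_sandwich; [exact: mt|exact: mt| |] => x e e0; rewrite !bE.
    by apply: eq_law_laplace_ge0 => // w; exact: normr_ge0.
  by apply: eq_law_laplace_ge0 => // w; exact: normr_ge0.
move=> /(eq_dist_comp (measurable_tnth ord0)).
apply: eq_dist_ae.
- by apply: filterS X0 => w /= h; rewrite tnth_mktuple /X1 ger0_norm.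
- by apply: filterS Y0 => w /= h; rewrite tnth_mktuple /Y1 ger0_norm.
Qed.

End laplace_uniqueness.

(** * Approximation from the right along grids *)

Section grids.
Set Implicit Arguments.
Unset Strict Implicit.
Context {R : realType}.

(** The strict inequality [grid_above_gt] is the reason for rounding to the
next grid point even when r is on the grid: right limits are taken along times
different from the limit. *)
Definition grid_above (n : nat) (r : R) : R :=
  (Num.truncn (n.+1%:R * r)).+1%:R / n.+1%:R.

Lemma grid_above_gt n r : r < grid_above n r.
Proof. by rewrite ltr_pdivlMr ?ltr0n// mulrC truncnS_gt. Qed.

Lemma grid_above_le n r : 0 <= r -> grid_above n r <= r + n.+1%:R^-1.
Proof.
move=> r0; rewrite ler_pdivrMr ?ltr0n// mulrDl mulVf ?pnatr_eq0//.
by rewrite -natr1 lerD2r mulrC truncn_le// mulr_ge0.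
Qed.

Lemma cvg_grid_above (r : R) : 0 <= r -> grid_above n r @[n --> \oo] --> r.
Proof.
move=> r0; apply: (squeeze_cvgr (f := cst r) (h := fun n => r + harmonic n)).
- by apply: nearW => n; rewrite (ltW (grid_above_gt n r)) grid_above_le.
- exact: cvg_cst.
- rewrite -[X in _ --> X]addr0; apply: cvgD; first exact: cvg_cst.
  exact: cvg_harmonic.
Qed.

Lemma cadlag_cvg_grid (f : R -> R) (b r : R) : cadlag f -> 0 < b -> 0 <= r ->
  f (b * grid_above n r) @[n --> \oo] --> f (b * r).
Proof.
move=> [/(_ (b * r)) + _] b0 r0; rewrite mulr_ge0// ?ltW// => /(_ isT).
move=> /cvg_at_rightP; apply; split=> [n|].
  by rewrite ltr_pM2l// grid_above_gt.
by apply: cvgMr; exact: cvg_grid_above.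
Qed.

End grids.

(** * Self-similarity of the subordinator *)

Section levy_increments.
Set Implicit Arguments.
Unset Strict Implicit.
Context {d : measure_display} {T : measurableType d} {R : realType}.
Context {P : probability T R}.

(** The increments over a regular grid are independent and distributed as X at
the mesh dl. *)
Lemma levy_increments_box (X : R -> {RV P >-> R}) (dl : R) (L : nat) (g : R -> R)
    (x : 'I_L -> R) : levy_process X -> 0 <= dl -> measurable_fun setT g ->
  P ((fun w => [tuple g (X (j.+1%:R * dl) w - X (j%:R * dl) w) | j < L]) @^-1` box x)
  = (\prod_(j < L) P ((g \o X dl) @^-1` `]-oo, x j[))%E.
Proof.
move=> [_ ind stat _ _] dl0 mg.
pose t j : R := j%:R * dl.
(* The events are indexed by nat, so x is extended by 0 beyond L. *)
pose B j := g @^-1` `]-oo, oapp x 0 (insub j)[.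
have mB j : measurable (B j) by apply: measurable_preimage.
have B_ord (j : 'I_L) : B j = g @^-1` `]-oo, x j[ by rewrite /B valK.
have nd : nondecreasing_seq t.
  by move=> m n mn; rewrite ler_wpM2r// ler_nat.
have := ind t _ nd L B mB; rewrite /t mul0r lexx => /(_ isT).
have -> : \bigcap_(i < L) [set w | B i (X (i.+1%:R * dl) w - X (i%:R * dl) w)] =
    (fun w => [tuple g (X (j.+1%:R * dl) w - X (j%:R * dl) w) | j < L]) @^-1` box x.
  apply/seteqP; split=> w /= h i.
    have := h i (ltn_ord i).
    by rewrite /= B_ord/= in_itv/= tnth_mktuple.
  move=> iL; have := h (Ordinal iL).
  by rewrite tnth_mktuple /= (B_ord (Ordinal iL)) /= in_itv.
move=> ->; apply: eq_bigr => j _.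
have jd : 0 <= j%:R * dl by rewrite mulr_ge0.
have := stat _ _ jd dl0.
have -> : j%:R * dl + dl = j.+1%:R * dl by rewrite -natr1 mulrDl mul1r.
move=> /eq_distP.
have mX : measurable_fun setT (fun w => X (j.+1%:R * dl) w - X (j%:R * dl) w).
  by apply: measurable_funB; exact: measurable_funPT.
move=> /(_ mX (measurable_funPT _) _ (mB j)) h.
rewrite B_ord in h *; exact: h.
Qed.

End levy_increments.

Section stable_subordinator.
Set Implicit Arguments.
Unset Strict Implicit.
Context {d : measure_display} {T : measurableType d} {R : realType}.
Context {P : probability T R}.
Variables (D : R -> {RV P >-> R}) (alpha c : R).
Hypothesis alpha01 : 0 < alpha < 1.
Hypothesis hD : stable_subordinator D alpha c.

Lemma subordinator_ge0 : \forall w \ae P, forall t, 0 <= t -> 0 <= D t w.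
Proof.
have [[D0 _ _ _ _] mono _] := hD.
by apply: filterS2 D0 mono => w w0 h t t0; rewrite -w0 h.
Qed.

(** Both sides have Laplace transform exp(-b t c u^alpha) at u. *)
Lemma subordinator_scale (b t : R) : 0 < b -> 0 <= t ->
  eq_dist P (D (b * t)) (fun w => b `^ (1 / alpha) * D t w).
Proof.
move=> b0 t0; have [_ _ lap] := hD.
have bt0 : 0 <= b * t by rewrite mulr_ge0// ltW.
have a0 : alpha != 0 by case/andP: alpha01 => /lt0r_neq0.
apply: eq_dist_laplace.
- exact: measurable_funPT.
- by apply: measurable_funM => //; exact: measurable_funPT.
- by apply: filterS subordinator_ge0 => w; exact.
- by apply: filterS subordinator_ge0 => w h; rewrite mulr_ge0 ?powR_ge0// h.
- move=> n; rewrite lap//.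
  have -> : (fun w => expR (- (n%:R * (b `^ (1 / alpha) * D t w)))) =
            (fun w => expR (- ((n%:R * b `^ (1 / alpha)) * D t w))).
    by apply/funext => w; rewrite mulrA.
  rewrite lap ?mulr_ge0 ?powR_ge0//; congr (expR (- _))%:E.
  rewrite powRM ?powR_ge0// -powRrM mul1r mulVf// powRr1 ?(ltW b0)//.
  ring.
Qed.

(** D at a grid point is a sum of increments over the mesh, so the vectors on
both sides are images of vectors of independent increments under the same map
[s], and one-dimensional scaling is enough. *)
Lemma subordinator_selfsimilar_grid (b dl : R) k (p : 'I_k -> nat) : 0 < b -> 0 <= dl ->
  eq_dist P (fun w => [tuple D (b * ((p i)%:R * dl)) w | i < k])
            (fun w => [tuple b `^ (1 / alpha) * D ((p i)%:R * dl) w | i < k]).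
Proof.
move=> b0 dl0; have [[D0 _ _ _ _] _ _] := hD; have lD : levy_process D by case: hD.
pose L := (\sum_(i < k) p i)%N.
have pL i : (p i <= L)%N by rewrite /L (bigD1 i)//= leq_addr.
have bdl0 : 0 <= b * dl by rewrite mulr_ge0// ltW.
pose incr (g : R -> R) (e : R) w :=
  [tuple g (D (j.+1%:R * e) w - D (j%:R * e) w) | j < L].
have mincr g e : measurable_fun setT g -> measurable_fun setT (incr g e).
  move=> mg; apply: measurable_mktuple => j; apply: measurableT_comp => //.
  by apply: measurable_funB; exact: measurable_funPT.
pose s (y : L.-tuple R) : k.-tuple R :=
  [tuple \sum_(j < L | (j < p i)%N) tnth y j | i < k].
have ms : measurable_fun setT s.
  apply: measurable_mktuple => i.
  under eq_fun do rewrite big_mkcond/=.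
  apply: measurable_sum => j; case: (j < p i)%N; last exact: measurable_cst.
  exact: measurable_tnth.
have sE (a e : R) : \forall w \ae P,
    [tuple a * D ((p i)%:R * e) w | i < k] = s (incr ( *%R a) e w).
  apply: filterS D0 => w w0; apply: eq_from_tnth => i; rewrite !tnth_mktuple.
  under eq_bigr do rewrite tnth_mktuple.
  rewrite -mulr_sumr; congr (_ * _).
  rewrite -(big_mkord (fun j => (j < p i)%N)
    (fun j => D (j.+1%:R * e) w - D (j%:R * e) w)).
  rewrite -(big_nat_widen 0 (p i) L xpredT _ (pL i)) telescope_sumr//.
  by rewrite mul0r w0 subr0.
have m1 : measurable_fun setT ( *%R (1 : R)) by exact: mulrl_measurable.
have mb : measurable_fun setT ( *%R (b `^ (1 / alpha))) by exact: mulrl_measurable.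
have ED : eq_dist P (incr ( *%R 1) (b * dl)) (incr ( *%R (b `^ (1 / alpha))) dl).
  apply/(eq_distP P (mincr _ _ m1) (mincr _ _ mb)).
  apply: eq_law_box; [exact: mincr|exact: mincr|] => x.
  rewrite !levy_increments_box//; apply: eq_bigr => j _.
  have -> : *%R 1 \o D (b * dl) = D (b * dl).
    by apply/funext => w /=; rewrite mul1r.
  have mD : measurable_fun setT (fun w => b `^ (1 / alpha) * D dl w).
    by apply: measurable_funM => //; exact: measurable_funPT.
  by apply: (eq_distP P (measurable_funPT _) mD).1 => //; exact: subordinator_scale.
have {ED} := eq_dist_comp ms ED.
apply: eq_dist_ae; last exact: sE.
apply: filterS (sE 1 (b * dl)) => w /= <-; apply: eq_from_tnth => i.
by rewrite !tnth_mktuple mul1r mulrCA.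
Qed.

(** Right-continuity reduces arbitrary times to those of a grid, with no need
to sort the times or to separate equal ones. *)
Lemma subordinator_selfsimilar (b : R) k (r : 'I_k -> R) : 0 < b ->
  (forall i, 0 <= r i) ->
  eq_dist P (fun w => [tuple D (b * r i) w | i < k])
            (fun w => [tuple b `^ (1 / alpha) * D (r i) w | i < k]).
Proof.
move=> b0 r0; have [[_ _ _ _ cad] _ _] := hD.
apply: (@eq_dist_cvg _ _ _ P k
  (fun n w => [tuple D (b * grid_above n (r i)) w | i < k])
  (fun n w => [tuple b `^ (1 / alpha) * D (grid_above n (r i)) w | i < k])).
- by move=> n; apply: subordinator_selfsimilar_grid => //; rewrite invr_ge0.
- apply: filterS cad => w cw i; rewrite tnth_mktuple.
  under eq_fun do rewrite tnth_mktuple.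
  exact: (@cadlag_cvg_grid _ (D ^~ w)).
- apply: filterS cad => w cw i; rewrite tnth_mktuple.
  under eq_fun do rewrite tnth_mktuple.
  apply: cvgMr; have := @cadlag_cvg_grid _ (D ^~ w) 1 (r i) cw ltr01 (r0 i).
  by rewrite mul1r; under eq_fun do rewrite mul1r.
Qed.

End stable_subordinator.

(** * The inverse subordinator *)

Section inverse_subordinator.
Set Implicit Arguments.
Unset Strict Implicit.
Context {d : measure_display} {T : measurableType d} {R : realType}.
Context {P : probability T R}.
Variables (D : R -> {RV P >-> R}) (alpha c : R).
Hypothesis alpha01 : 0 < alpha < 1.
Hypothesis c0 : 0 < c.
Hypothesis hD : stable_subordinator D alpha c.

(** T with the sigma-algebra of the process X, whose measurable sets are
[process_sigma_algebra X]; as a measurable type, it gives access to the general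
closure properties of measurable functions. *)
Definition generated_space (X : R -> {RV P >-> R}) : measurableType _ :=
  g_sigma_algebraType (\bigcup_(t in [set t : R | 0 <= t])
    preimage_set_system setT (X t) measurable).

Lemma measurable_generated (X : R -> {RV P >-> R}) t : 0 <= t ->
  @measurable_fun _ _ (generated_space X) R setT (X t).
Proof.
move=> t0 _ B mB; apply: sub_sigma_algebra; exists t => //.
by exists B.
Qed.

Lemma measurable_generatedW (X : R -> {RV P >-> R}) {d'} {U : measurableType d'}
    (f : T -> U) :
  @measurable_fun _ _ (generated_space X) U setT f -> measurable_fun setT f.
Proof.
move=> mf _ B mB; have := mf measurableT B mB.
move: (setT `&` _); apply: smallest_sub; first exact: sigma_algebra_measurable.
by move=> _ [t _ [C mC <-]]; apply: measurable_funPT.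
Qed.

(** Markov's inequality for exp(-D_t). *)
Lemma subordinator_tail_le (t s : R) : 0 <= t ->
  (P [set w | (D t w <= s)%R] <= (expR s * expR (- (t * c)))%:E)%E.
Proof.
move=> t0; have [_ _ lap] := hD.
have mA : measurable [set w | D t w <= s].
  rewrite (_ : [set _ | _] = D t @^-1` `]-oo, s]).
    by apply: measurable_preimage => //; exact: measurable_funPT.
  by apply/seteqP; split=> w /=; rewrite in_itv.
have mE : measurable_fun setT (fun w => expR (- (1 * D t w))).
  apply: measurableT_comp => //; apply: measurable_funN.
  by apply: measurable_funM => //; exact: measurable_funPT.
have := lap t 1 t0 ler01; rewrite powR1 mulr1 EFinM => <-.
rewrite -(expectation_indic _ mA).
apply: (@le_trans _ _ (expectation P (fun w => expR s * expR (- (1 * D t w))))).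
  apply: expectation_le.
  - exact: measurable_indic.
  - by apply: measurable_funM.
  - by move=> w; rewrite indicE.
  - by move=> w; rewrite mulr_ge0 ?expR_ge0.
  - apply: aeW => w; rewrite -expRD mul1r indicE.
    have [|_] := boolP (w \in _); last exact: expR_ge0.
    by rewrite inE/= => h; rewrite -expR0 ler_expR subr_ge0.
rewrite unlock; under eq_integral do rewrite EFinM.
rewrite ge0_integralZl_EFin ?expR_ge0//.
exact/measurable_EFinP.
Qed.

(** D_n <= s has probability at most e^s e^(-n c), for every n. *)
Lemma subordinator_unbounded (s : R) :
  \forall w \ae P, exists t, 0 <= t /\ s < D t w.
Proof.
pose N := \bigcap_n [set w | D n%:R w <= s].
have mn n : measurable [set w | D n%:R w <= s].
  rewrite (_ : [set _ | _] = D n%:R @^-1` `]-oo, s]).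
    by apply: measurable_preimage => //; exact: measurable_funPT.
  by apply/seteqP; split=> w /=; rewrite in_itv.
have mN : measurable N by exact: bigcapT_measurable.
exists N; split => //; last first.
  move=> w /= h n _ /=; rewrite leNgt; apply/negP => sD; apply: h.
  by exists n%:R.
apply/eqP; rewrite eq_le measure_ge0 andbT.
apply/lee_addgt0Pr => e e0; rewrite add0e.
have c1 : `|expR (- c)| < 1.
  by rewrite ger0_norm ?expR_ge0// -expR0 ltr_expR oppr_lt0.
have [n _ hn] : \forall n \near \oo, expR (- c) ^+ n < e / expR s.
  by apply: (cvgr_lt _ (cvg_expr c1)); rewrite divr_gt0// expR_gt0.
apply: (@le_trans _ _ (P [set w | D n%:R w <= s])).
  by apply: le_measure; rewrite ?inE// => w; apply.
apply: (le_trans (subordinator_tail_le _ _)) => //.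
rewrite lee_fin -mulrN expRM_natl mulrC -ler_pdivlMr ?expR_gt0//.
by rewrite ltW// hn /=.
Qed.

(** A version of [inverse_process] with countably many constraints, hence
measurable everywhere with respect to the process D. *)
Definition rational_inverse (t : R) (w : T) : R :=
  inf [set s : R | exists2 q : rat, s = ratr q & 0 <= s /\ t < D s w].

Lemma rational_inverse_ge0 t w : 0 <= rational_inverse t w.
Proof.
rewrite /rational_inverse; set S := [set _ | _].
have [->|S0] := eqVneq S set0; first by rewrite inf0.
by apply: lb_le_inf; [exact/set0P|move=> x [q _ []]].
Qed.

Lemma inverse_process_rational t : \forall w \ae P,
  inverse_process D t w = rational_inverse t w.
Proof.
have [_ mono _] := hD.
apply: filterS mono => w mw.
rewrite /inverse_process /rational_inverse; set S := [set _ | _].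
set Q := [set s | exists2 q : rat, _ & _].
have QS : Q `<=` S by move=> x [q _ []].
have lS : has_lbound S by exists 0 => x [].
have lQ : has_lbound Q by exists 0 => x /QS[].
have dense x y : S x -> x < y -> exists2 z, Q z & z < y.
  move=> [x0 xt] xy; have [q] := rat_in_itvoo xy.
  rewrite in_itv/= => /andP[xq qy]; exists (ratr q) => //; exists q => //.
  have q0 : 0 <= ratr q :> R by rewrite (le_trans x0)// ltW.
  by split=> //; apply: lt_le_trans xt _; apply: mw => //; exact: ltW.
have [S0|/set0P[x Sx]] := eqVneq S set0.
  suff -> : Q = set0 by rewrite S0.
  by apply/seteqP; split=> // x /QS; rewrite S0.
have [z Qz _] : exists2 z, Q z & z < x + 1 by apply: dense Sx _; rewrite ltrDl.
apply/eqP; rewrite eq_le; apply/andP; split.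
  by apply: lb_le_inf; [exists z|move=> y /QS; exact: ge_inf].
apply: lb_le_inf; [by exists x|move=> y Sy].
apply/ler_addgt0Pr => e e0.
have [u Qu uy] : exists2 u, Q u & u < y + e by apply: dense Sy _; rewrite ltrDl.
by apply: le_trans (ge_inf lQ Qu) (ltW uy).
Qed.

Lemma measurable_rational_inverse t :
  @measurable_fun _ _ (generated_space D) R setT (rational_inverse t).
Proof.
apply: (measurability _ (RGenInftyO.measurableE R)).
move=> _ [_ [x ->] <-]; rewrite setTI.
pose F (q : rat) : set (generated_space D) :=
  if 0 <= ratr q :> R then D (ratr q) @^-1` `]t, +oo[ else set0.
have mF q : measurable (F q).
  rewrite /F; case: ifP => // q0; apply: measurable_preimage => //.
  exact: measurable_generated.
have FE q w : F q w <-> 0 <= ratr q :> R /\ t < D (ratr q) w.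
  by rewrite /F; case: ifP => q0; rewrite /= ?in_itv/= ?andbT; split=> // -[].
(* The second part of the union accounts for the paths that never exceed t,
   for which the infimum is 0 by convention. *)
have -> : rational_inverse t @^-1` `]-oo, x[ =
    (\bigcup_q (if ratr q < x then F q else set0)) `|`
    (if 0 < x then ~` (\bigcup_q F q) else set0).
  apply/seteqP; split=> w; rewrite /= in_itv/=.
    have [S0|/set0P S0] := eqVneq
        [set s : R | exists2 q : rat, s = ratr q & 0 <= s /\ t < D s w] set0.
      rewrite /rational_inverse S0 inf0 => x0; right; rewrite x0.
      move=> [q _ /FE Fq].
      by have : set0 (ratr q : R) by rewrite -S0; exists q.
    move=> /(inf_lt S0)[_ [q -> Dq] qx]; left.
    by exists q => //; rewrite qx; exact/FE.
  move=> [[q _]|].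
    case: ifP => // qx /FE Fq; apply: le_lt_trans qx; apply: ge_inf.
      by exists 0 => y [? _ []].
    by exists q.
  case: ifP => // x0 nF; rewrite /rational_inverse (_ : [set _ | _] = set0) ?inf0//.
  apply/seteqP; split=> // y [q yq Dq]; apply: nF; exists q => //; apply/FE.
  by rewrite -yq.
apply: measurableU.
  by apply: bigcupT_measurable_rat => q; case: ifP.
case: ifP => // _; apply: measurableC.
exact: bigcupT_measurable_rat.
Qed.

(** The almost sure implications E_t < r => D_r > t => E_t <= r behind the
passage from D to its inverse. *)
Lemma inverse_between (t : R) : \forall w \ae P, forall r,
  (rational_inverse t w < r -> 0 <= r /\ t < D r w) /\
  (0 <= r -> t < D r w -> rational_inverse t w <= r).
Proof.
have [_ mono _] := hD.
apply: filterS3 mono (subordinator_unbounded t) (inverse_process_rational t).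
move=> w mw [x [x0 xt]] <- r; split.
  move=> /inf_lt[|y [y0 ty] yr]; first by exists x.
  split; first by rewrite (le_trans y0)// ltW.
  by apply: lt_le_trans ty _; apply: mw => //; exact: ltW.
by move=> r0 tr; apply: ge_inf; [exists 0 => y []|].
Qed.

Lemma first_passage_selfsimilar (a : R) k (s x : 'I_k -> R) : 0 < a ->
  (forall i, 0 <= x i) ->
  P [set w | forall i, a * s i < D (x i) w] =
  P [set w | forall i, s i < D (x i / a `^ alpha) w].
Proof.
move=> a0 x0; pose b := a `^ alpha.
have b0 : 0 < b by exact: powR_gt0.
have al0 : alpha != 0 by case/andP: alpha01 => /lt0r_neq0.
have ba : b `^ (1 / alpha) = a.
  by rewrite /b -powRrM mul1r mulfV// powRr1// ltW.
have xb i : 0 <= x i / b by rewrite divr_ge0// ltW.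
have := subordinator_selfsimilar alpha01 hD b0 xb.
rewrite ba.
set X := (fun w => [tuple D (b * (x i / b)) w | i < k]).
set Y := (fun w => [tuple a * D (x i / b) w | i < k]).
have mX : measurable_fun setT X.
  by apply: measurable_mktuple => i; exact: measurable_funPT.
have mY : measurable_fun setT Y.
  by apply: measurable_mktuple => i; apply: measurable_funM.
move=> /(eq_distP P mX mY)/(_ [set t | forall i, `]a * s i, +oo[%classic (tnth t i)]).
have -> : X @^-1` [set t | forall i, `]a * s i, +oo[%classic (tnth t i)] =
    [set w | forall i, a * s i < D (x i) w].
  apply/seteqP; split=> w h i; have := h i; rewrite /= in_itv/= andbT tnth_mktuple.
    by rewrite (mulrC b) divfK// gt_eqF.
  by rewrite (mulrC b) divfK// gt_eqF.
have -> : Y @^-1` [set t | forall i, `]a * s i, +oo[%classic (tnth t i)] =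
    [set w | forall i, s i < D (x i / b) w].
  by apply/seteqP; split=> w h i; have := h i;
     rewrite /= in_itv/= andbT tnth_mktuple ltr_pM2l.
apply; apply: (measurable_rectangle (B := fun i => `]a * s i, +oo[%classic)) => i.
exact: measurable_itv.
Qed.

(** Both joint distribution functions lie between those of first-passage events
of D, which [first_passage_selfsimilar] identifies. *)
Lemma inverse_selfsimilar (a : R) k (s : 'I_k -> R) : 0 < a ->
  eq_dist P (fun w => [tuple rational_inverse (a * s i) w | i < k])
            (fun w => [tuple a `^ alpha * rational_inverse (s i) w | i < k]).
Proof.
move=> a0; pose b := a `^ alpha; have b0 : 0 < b by exact: powR_gt0.
set X := (fun w => [tuple rational_inverse (a * s i) w | i < k]).
set Y := (fun w => [tuple b * rational_inverse (s i) w | i < k]).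
have mE t : measurable_fun setT (rational_inverse t).
  by apply: measurable_generatedW; exact: measurable_rational_inverse.
have mX : measurable_fun setT X by exact: measurable_mktuple.
have mY : measurable_fun setT Y.
  by apply: measurable_mktuple => i; apply: measurable_funM.
have btw (t : 'I_k -> R) : \forall w \ae P, forall i r,
  (rational_inverse (t i) w < r -> 0 <= r /\ t i < D r w) /\
  (0 <= r -> t i < D r w -> rational_inverse (t i) w <= r).
  by apply: filter_forall => i; exact: inverse_between.
have mV (t x : 'I_k -> R) : measurable [set w | forall i, t i < D (x i) w].
  have -> : [set w | forall i, t i < D (x i) w] =
     (fun w => [tuple D (x i) w | i < k]) @^-1`
     [set y | forall i, `]t i, +oo[%classic (tnth y i)].
    by apply/seteqP; split=> w h i; have := h i;
      rewrite /= in_itv/= andbT tnth_mktuple.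
  apply: measurable_preimage.
    by apply: measurable_mktuple => i; exact: measurable_funPT.
  apply: (measurable_rectangle (B := fun i => `]t i, +oo[%classic)) => i.
  exact: measurable_itv.
have mbox (Z : T -> k.-tuple R) x : measurable_fun setT Z ->
    measurable (Z @^-1` box x).
  by move=> mZ; apply: measurable_preimage => //; exact: measurable_box.
have X0 w i : 0 <= tnth (X w) i by rewrite tnth_mktuple rational_inverse_ge0.
have Y0 w i : 0 <= tnth (Y w) i.
  by rewrite tnth_mktuple mulr_ge0 ?powR_ge0// rational_inverse_ge0.
have neg (Z : T -> k.-tuple R) (x : 'I_k -> R) : (forall w i, 0 <= tnth (Z w) i) ->
    ~ (forall i, 0 <= x i) -> P (Z @^-1` box x) = 0%E.
  move=> Z0 /existsNP[i /negP]; rewrite -ltNge => xi.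
  rewrite (_ : _ @^-1` _ = set0) ?measure0//.
  apply/seteqP; split=> // w /(_ i) /lt_trans /(_ xi).
  by rewrite ltNge Z0.
apply: eq_dist_sandwich => // x e e0.
- have [x0|/neg ->//] := pselect (forall i, 0 <= x i).
  apply: (@le_trans _ _ (P [set w | forall i, a * s i < D (x i) w])).
    apply: le_measure_ae; [exact: mbox|exact: mV|].
    apply: filterS (btw (fun i => a * s i)) => w h Xx i.
    by apply: ((h i (x i)).1 _).2; have := Xx i; rewrite tnth_mktuple.
  rewrite first_passage_selfsimilar//.
  apply: le_measure_ae; [exact: mV|exact: mbox|].
  apply: filterS (btw s) => w h Dx i; rewrite tnth_mktuple.
  apply: (@le_lt_trans _ _ (x i)); last by rewrite ltrDl.
  rewrite mulrC -ler_pdivlMr//; apply: (h i _).2; last exact: Dx.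
  by rewrite divr_ge0// ltW.
- have [x0|/neg ->//] := pselect (forall i, 0 <= x i).
  apply: (@le_trans _ _ (P [set w | forall i, s i < D (x i / b) w])).
    apply: le_measure_ae; [exact: mbox|exact: mV|].
    apply: filterS (btw s) => w h Yx i.
    apply: ((h i _).1 _).2; have := Yx i; rewrite tnth_mktuple.
    by rewrite mulrC -ltr_pdivlMr.
  rewrite -first_passage_selfsimilar//.
  apply: le_measure_ae; [exact: mV|exact: mbox|].
  apply: filterS (btw (fun i => a * s i)) => w h Dx i; rewrite tnth_mktuple.
  apply: (@le_lt_trans _ _ (x i)); last by rewrite ltrDl.
  by apply: (h i _).2; last exact: Dx.
Qed.

End inverse_subordinator.

(** * Evaluation at an independent discrete index *)

Section randomized_index.
Set Implicit Arguments.
Unset Strict Implicit.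
Context {d : measure_display} {T : measurableType d} {R : realType}.
Context {P : probability T R}.

(** The union over I is indexed by nat, through the codes of the elements of I,
to fit countable additivity. *)
Lemma preimage_randomized {I : countType} {U : Type} (S : T -> I)
    (X : I -> T -> U) (B : set U) :
  (fun w => X (S w) w) @^-1` B =
  \bigcup_p (if @pickle_inv I p is Some m
             then S @^-1` [set m] `&` X m @^-1` B else set0).
Proof.
apply/seteqP; split=> w /=.
  by move=> h; exists (pickle (S w)) => //; rewrite pickleK_inv.
by move=> [p _]; case: pickle_inv => // m [/= <-].
Qed.

(** Conditioning on a discrete variable S independent of the family X:
P(X_S in B) is the sum over m of P(S = m) P(X_m in B). *)
Lemma eq_dist_randomized {I : countType} {d'} {U : measurableType d'}
    (S S' : T -> I) (X Y : I -> T -> U) :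
  (forall m, measurable (S @^-1` [set m])) ->
  (forall m, measurable (S' @^-1` [set m])) ->
  (forall m, measurable_fun setT (X m)) -> (forall m, measurable_fun setT (Y m)) ->
  (forall m, P (S @^-1` [set m]) = P (S' @^-1` [set m])) ->
  (forall m, eq_dist P (X m) (Y m)) ->
  (forall m B, measurable B -> P (S @^-1` [set m] `&` X m @^-1` B) =
                               (P (S @^-1` [set m]) * P (X m @^-1` B))%E) ->
  (forall m B, measurable B -> P (S' @^-1` [set m] `&` Y m @^-1` B) =
                               (P (S' @^-1` [set m]) * P (Y m @^-1` B))%E) ->
  eq_dist P (fun w => X (S w) w) (fun w => Y (S' w) w).
Proof.
move=> mS mS' mX mY SS' XY indX indY.
have mF (Z : T -> I) (V : I -> T -> U) B p :
    (forall m, measurable (Z @^-1` [set m])) -> (forall m, measurable_fun setT (V m)) ->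
    measurable B ->
    measurable (if @pickle_inv I p is Some m
                then Z @^-1` [set m] `&` V m @^-1` B else set0).
  move=> mZ mV mB; case: pickle_inv => // m; apply: measurableI => //.
  exact: measurable_preimage.
have mZV (Z : T -> I) (V : I -> T -> U) :
    (forall m, measurable (Z @^-1` [set m])) -> (forall m, measurable_fun setT (V m)) ->
    measurable_fun setT (fun w => V (Z w) w).
  move=> mZ mV _ B mB; rewrite setTI preimage_randomized.
  by apply: bigcupT_measurable => p; exact: mF.
have PZV (Z : T -> I) (V : I -> T -> U) B :
    (forall m, measurable (Z @^-1` [set m])) -> (forall m, measurable_fun setT (V m)) ->
    measurable B ->
    P ((fun w => V (Z w) w) @^-1` B) =
    (\sum_(p <oo) P (if @pickle_inv I p is Some m
                     then Z @^-1` [set m] `&` V m @^-1` B else set0))%E.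
  move=> mZ mV mB; rewrite preimage_randomized measure_bigcup.
  - by apply: eq_eseriesl => p; rewrite in_setT.
  - by move=> p _; exact: mF.
  - move=> p q _ _ [w []].
    case Ep: (pickle_inv p) => [m|//] [/= Zm _].
    case Eq: (pickle_inv q) => [m'|//] [/= Zm' _].
    have := @pickle_invK I p; have := @pickle_invK I q.
    by rewrite /ocancel/= Ep Eq /= -Zm -Zm' => <- <-.
apply/(eq_distP P (mZV _ _ mS mX) (mZV _ _ mS' mY)) => B mB.
rewrite !PZV//; apply: eq_eseriesr => p _; case: pickle_inv => // m.
rewrite indX// indY// SS'; congr (_ * _)%E.
exact: (eq_distP P (mX m) (mY m)).1.
Qed.

End randomized_index.

(** * Self-similarity of the time-changed process *)

Section time_change.
Set Implicit Arguments.
Unset Strict Implicit.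
Context {d : measure_display} {T : measurableType d} {R : realType}.
Context {P : probability T R}.

Lemma measurable_truncn_fiber (m : nat) : measurable [set y : R | Num.truncn y = m].
Proof.
have mle n : measurable [set y : R | (Num.truncn y <= n)%N].
  rewrite (_ : [set _ | _] = `]-oo, n.+1%:R[%classic); first exact: measurable_itv.
  by apply/seteqP; split=> y /=; rewrite in_itv/= truncn_le_nat.
case: m => [|m].
  rewrite (_ : [set _ | _] = [set y : R | (Num.truncn y <= 0)%N]); first exact: mle.
  by apply/seteqP; split=> y /= => [->//|]; rewrite leqn0 => /eqP.
rewrite (_ : [set _ | _] = [set y : R | (Num.truncn y <= m.+1)%N] `\`
                           [set y : R | (Num.truncn y <= m)%N]).
  exact: measurableD.
apply/seteqP; split=> y /= => [->|[h /negP]]; first by rewrite ltnn.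
by rewrite -ltnNge => h2; apply/eqP; rewrite eqn_leq h.
Qed.

Definition grid_index (n : nat) {k} (y : k.-tuple R) : k.-tuple nat :=
  [tuple Num.truncn (n.+1%:R * tnth y i) | i < k].

Lemma measurable_grid_index_fiber n k (m : k.-tuple nat) :
  measurable (@grid_index n k @^-1` [set m]).
Proof.
pose B i := ( *%R (n.+1%:R : R)) @^-1` [set y | Num.truncn y = tnth m i].
rewrite (_ : _ @^-1` _ = [set t : k.-tuple R | forall i, B i (tnth t i)]).
  apply: measurable_rectangle => i; apply: measurable_preimage.
    exact: mulrl_measurable.
  exact: measurable_truncn_fiber.
apply/seteqP; split=> t; rewrite /grid_index /B/=.
  by move=> <- i; rewrite tnth_mktuple.
by move=> h; apply: eq_from_tnth => i; rewrite tnth_mktuple h.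
Qed.

Variables (A D : R -> {RV P >-> R}) (alpha c H : R).
Hypothesis alpha01 : 0 < alpha < 1.
Hypothesis c0 : 0 < c.
Hypothesis hA : strictly_stable A H.
Hypothesis hD : stable_subordinator D alpha c.
Hypothesis hAD : independent_processes A D.

Lemma independent_processes_fun {d1 d2} {U : measurableType d1} {V : measurableType d2}
    (X : T -> U) (Y : T -> V) B C :
  @measurable_fun _ _ (generated_space D) U setT X ->
  @measurable_fun _ _ (generated_space A) V setT Y ->
  measurable B -> measurable C ->
  P (X @^-1` B `&` Y @^-1` C) = (P (X @^-1` B) * P (Y @^-1` C))%E.
Proof.
move=> mX mY mB mC; rewrite setIC muleC; apply: hAD.
  by rewrite -[_ @^-1` _]setTI; exact: mY.
by rewrite -[_ @^-1` _]setTI; exact: mX.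
Qed.

(** On the grid, E enters only through the integers [grid_index], which have
the same joint law for E_(a s) / b and for E_s; for fixed values of these
integers the two sides are A at times b r and b^H A at times r. *)
Lemma time_change_selfsimilar_grid (a : R) (n : nat) k (s : 'I_k -> R) : 0 < a ->
  let b := a `^ alpha in
  eq_dist P
    (fun w => [tuple A (b * grid_above n (b^-1 * rational_inverse D (a * s i) w)) w
              | i < k])
    (fun w => [tuple b `^ H * A (grid_above n (rational_inverse D (s i) w)) w
              | i < k]).
Proof.
move=> a0 b; have b0 : 0 < b by exact: powR_gt0.
have [_ stA] := hA.
pose E1 w := [tuple b^-1 * rational_inverse D (a * s i) w | i < k].
pose E2 w := [tuple rational_inverse D (s i) w | i < k].
have mE1 : @measurable_fun _ _ (generated_space D) _ setT E1.
  apply: measurable_mktuple => i; apply: measurable_funM => //.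
  exact: measurable_rational_inverse.
have mE2 : @measurable_fun _ _ (generated_space D) _ setT E2.
  apply: measurable_mktuple => i; exact: measurable_rational_inverse.
have E12 : eq_dist P E1 E2.
  pose g (y : k.-tuple R) := [tuple b^-1 * tnth y i | i < k].
  have mg : measurable_fun setT g.
    apply: measurable_mktuple => i; apply: measurable_funM => //.
    exact: measurable_tnth.
  have := eq_dist_comp mg (inverse_selfsimilar alpha01 c0 hD s a0).
  apply: eq_dist_ae; apply: aeW => w; apply: eq_from_tnth => i;
    rewrite !tnth_mktuple//.
  by rewrite mulKf// gt_eqF.
pose X (m : k.-tuple nat) w :=
  [tuple A (b * ((tnth m i).+1%:R / n.+1%:R)) w | i < k].
pose Y (m : k.-tuple nat) w :=
  [tuple b `^ H * A ((tnth m i).+1%:R / n.+1%:R) w | i < k].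
have t0 (m : k.-tuple nat) i : 0 <= (tnth m i).+1%:R / n.+1%:R :> R.
  by rewrite divr_ge0.
have mX m : @measurable_fun _ _ (generated_space A) _ setT (X m).
  apply: measurable_mktuple => i; apply: measurable_generated.
  by rewrite mulr_ge0// ltW.
have mY m : @measurable_fun _ _ (generated_space A) _ setT (Y m).
  apply: measurable_mktuple => i; apply: measurable_funM => //.
  exact: measurable_generated.
have mI m := @measurable_grid_index_fiber n k m.
have : eq_dist P (fun w => X (grid_index n (E1 w)) w)
                 (fun w => Y (grid_index n (E2 w)) w).
  apply: eq_dist_randomized.
  - move=> m; apply: (measurable_preimage (f := E1)
      (B := grid_index n @^-1` [set m])) => //.
    exact: measurable_generatedW mE1.
  - move=> m; apply: (measurable_preimage (f := E2)
      (B := grid_index n @^-1` [set m])) => //.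
    exact: measurable_generatedW mE2.
  - by move=> m; exact: measurable_generatedW (mX m).
  - by move=> m; exact: measurable_generatedW (mY m).
  - move=> m; apply: ((eq_distP P (measurable_generatedW mE1)
      (measurable_generatedW mE2)).1 E12 (grid_index n @^-1` [set m])).
    exact: mI.
  - by move=> m; apply: stA.
  - move=> m B mB.
    exact: (independent_processes_fun mE1 (mX m) (mI m) mB).
  - move=> m B mB.
    exact: (independent_processes_fun mE2 (mY m) (mI m) mB).
apply: eq_dist_ae; apply: aeW => w; apply: eq_from_tnth => i;
  by rewrite !tnth_mktuple.
Qed.

Lemma time_change_selfsimilar (a : R) k (s : 'I_k -> R) : 0 < a ->
  eq_dist P
    (fun w => [tuple A (inverse_process D (a * s i) w) w | i < k])
    (fun w => [tuple (a `^ alpha) `^ H * A (inverse_process D (s i) w) w | i < k]).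
Proof.
move=> a0; pose b := a `^ alpha; have b0 : 0 < b by exact: powR_gt0.
have [[_ _ _ _ cad] _] := hA.
have invE (t : 'I_k -> R) : \forall w \ae P, forall i,
    inverse_process D (t i) w = rational_inverse D (t i) w.
  by apply: filter_forall => i; exact: inverse_process_rational hD _.
apply: (eq_dist_cvg (fun n => time_change_selfsimilar_grid n s a0)).
- apply: filterS2 cad (invE (fun i => a * s i)) => w cw ew i.
  rewrite tnth_mktuple ew; under eq_fun do rewrite tnth_mktuple.
  have r0 : 0 <= b^-1 * rational_inverse D (a * s i) w.
    by rewrite mulr_ge0 ?rational_inverse_ge0// invr_ge0 ltW.
  have := @cadlag_cvg_grid _ (A ^~ w) b _ cw b0 r0.
  by rewrite mulVKf// gt_eqF.
- apply: filterS2 cad (invE s) => w cw ew i.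
  rewrite tnth_mktuple ew; under eq_fun do rewrite tnth_mktuple.
  apply: cvgMr; have := @cadlag_cvg_grid _ (A ^~ w) 1 _ cw ltr01
    (rational_inverse_ge0 D (s i) w).
  by rewrite mul1r; under eq_fun do rewrite mul1r.
Qed.

End time_change.

Theorem corollary1 (d : measure_display) (T : measurableType d) (R : realType)
    (P : probability T R) (A D : R -> {RV P >-> R}) (alpha beta c : R)
    (hbeta : beta != 0) (halpha : 0 < alpha < 1) (hc : 0 < c)
    (hA : strictly_stable A (1 / beta))
    (hD : stable_subordinator D alpha c)
    (hAD : independent_processes A D)
    (a t0 : R) (ha : 0 < a) (ht0 : 0 < t0)
    (k : nat) (hk : (1 <= k)%N) (t : 'I_k -> R)
    (ht_pos : forall i, 0 < t i)
    (ht_incr : forall i j : 'I_k, (i < j)%N -> t i < t j) :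
  eq_dist P
    (fun w => [tuple time_changed_increment A D t0 (a * t i) w | i < k])
    (fun w => [tuple a `^ (alpha / beta) *
                     time_changed_increment A D (t0 / a) (t i) w | i < k]).
Proof.
(* Index 0 carries the time t0 / a from which the increments are taken. *)
pose s (i : 'I_k.+1) : R := oapp (fun j => t j + t0 / a) (t0 / a) (unlift ord0 i).
have s0 : s ord0 = t0 / a by rewrite /s unlift_none.
have sS j : s (lift ord0 j) = t j + t0 / a by rewrite /s liftK.
have as0 : a * s ord0 = t0 by rewrite s0 mulrC divfK// gt_eqF.
have asS j : a * s (lift ord0 j) = a * t j + t0.
  by rewrite sS mulrDr (mulrC a (t0 / a)) divfK// gt_eqF.
pose g (y : k.+1.-tuple R) := [tuple tnth y (lift ord0 j) - tnth y ord0 | j < k].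
have mg : measurable_fun setT g.
  by apply: measurable_mktuple => j; apply: measurable_funB; exact: measurable_tnth.
have := eq_dist_comp mg (time_change_selfsimilar halpha hc hA hD hAD s ha).
apply: eq_dist_ae; apply: aeW => w; apply: eq_from_tnth => j;
  rewrite !tnth_mktuple /time_changed_increment.
- by rewrite as0 asS.
- by rewrite s0 sS -mulrBr -powRrM mul1r.
Qed.
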